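(* Let $(H,[-,-,-])$ be an Abelian heap and let $\varepsilon,\iota$ be idempotent endomorphisms of $(H,[-,-,-])$ such that $\varepsilon\circ\iota=\iota\circ\varepsilon=\varepsilon$. Then $H$ is a left module over the truss $(\mathbb{Z},[-,-,-]_+,\cdot)$, where $[l,m,n]_+=l-m+n$ and $\cdot$ is the usual multiplication of integers, with the action, for all $n\in\mathbb{Z}$ and $x\in H$, $$n\triangleright x=\begin{cases}[[\iota(x),\varepsilon(x),\iota(x),\ldots,\varepsilon(x),\iota(x)]]_{n-1},& n>0,\\ [[\varepsilon(x),\iota(x),\varepsilon(x),\ldots,\iota(x),\varepsilon(x)]]_{|n|},& n\le 0,\end{cases}$$ where the entries alternate (there are $2n-1$ entries for $n>0$ and $2|n|+1$ entries for $n\le 0$).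
   Context: A heap is a non-empty set $H$ with a ternary operation $[-,-,-]$ satisfying $[v,w,[x,y,z]]=[[v,w,x],y,z]$ and $[x,x,y]=y=[y,x,x]$; it is Abelian if $[x,y,z]=[z,y,x]$. An endomorphism of a heap is a self-map preserving the ternary operation; it is idempotent if $\alpha\circ\alpha=\alpha$. For $k\ge 0$, the $(2k+1)$-ary operation is $[[x_1,x_2,\ldots,x_{2k+1}]]_k=[[\ldots[[x_1,x_2,x_3],x_4,x_5],\ldots],x_{2k},x_{2k+1}]$, with $[[x_1]]_0=x_1$. A truss is an Abelian heap $T$ with an associative binary operation (juxtaposition) satisfying $w[x,y,z]=[wx,wy,wz]$ and $[x,y,z]w=[xw,yw,zw]$. A left $T$-module is an Abelian heap $M$ with a map $T\times M\to M$, $(x,m)\mapsto x\triangleright m$, such that $(xy)\triangleright m=x\triangleright(y\triangleright m)$, $x\triangleright[m,m',m'']=[x\triangleright m,x\triangleright m',x\triangleright m'']$ and $[x,y,z]\triangleright m=[x\triangleright m,y\triangleright m,z\triangleright m]$. *)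

(* Defs.v *)
From mathcomp Require Import all_boot all_order all_algebra.

Set Implicit Arguments.
Unset Strict Implicit.
Unset Printing Implicit Defensive.

Import Order.TTheory GRing.Theory Num.Theory.
Local Open Scope ring_scope.

Record heap (H : Type) (br : H -> H -> H -> H) : Prop := Heap {
  heap_nonempty : inhabited H;
  heap_assoc : forall v w x y z, br v w (br x y z) = br (br v w x) y z;
  heap_malcev_l : forall x y, br x x y = y;
  heap_malcev_r : forall x y, br y x x = y
}.

Record abelian_heap (H : Type) (br : H -> H -> H -> H) : Prop := AbelianHeap {
  abelian_heap_heap : heap br;
  abelian_heap_sym : forall x y z, br x y z = br z y x
}.

Definition heap_endomorphism (H : Type) (br : H -> H -> H -> H)
    (f : H -> H) : Prop :=
  forall x y z, f (br x y z) = br (f x) (f y) (f z).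

Record truss (T : Type) (br : T -> T -> T -> T) (mul : T -> T -> T) : Prop :=
  Truss {
  truss_heap : abelian_heap br;
  truss_mulA : associative mul;
  truss_mulDr : forall w x y z,
    mul w (br x y z) = br (mul w x) (mul w y) (mul w z);
  truss_mulDl : forall w x y z,
    mul (br x y z) w = br (mul x w) (mul y w) (mul z w)
}.

(* No unit is assumed in a truss, so modules are not required to be unital. *)
Record left_module (T : Type) (tbr : T -> T -> T -> T) (tmul : T -> T -> T)
    (M : Type) (mbr : M -> M -> M -> M) (act : T -> M -> M) : Prop :=
  LeftModule {
  left_module_truss : truss tbr tmul;
  left_module_heap : abelian_heap mbr;
  left_module_actM : forall x y m, act (tmul x y) m = act x (act y m);
  left_module_actDr : forall x m m' m'',
    act x (mbr m m' m'') = mbr (act x m) (act x m') (act x m'');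
  left_module_actDl : forall x y z m,
    act (tbr x y z) m = mbr (act x m) (act y m) (act z m)
}.

(* The (2k+1)-ary operation [[x_1, ..., x_(2k+1)]]_k. The arguments are given
   as a sequence numbered from 0 (x_(i+1) is [x i]), of which only the first
   2k+1 entries are used. *)
Fixpoint iter_br (H : Type) (br : H -> H -> H -> H) (k : nat) (x : nat -> H)
    : H :=
  if k is k'.+1 then br (iter_br br k' x) (x k'.*2.+1) (x k'.*2.+2) else x 0%N.

(* a, b, a, b, ... *)
Definition alternate (H : Type) (a b : H) (i : nat) : H :=
  if odd i then b else a.

Definition int_br (l m n : int) : int := l - m + n.

Definition int_act (H : Type) (br : H -> H -> H -> H) (eps iota : H -> H)
    (n : int) (x : H) : H :=
  if 0 < n then iter_br br `|n|.-1%N (alternate (iota x) (eps x))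
  else iter_br br `|n|%N (alternate (eps x) (iota x)).

(* Main.v *)
Require Import Defs.
From mathcomp Require Import all_boot all_order all_algebra.
From mathcomp Require Import ring.

(** Write [e = eps x] and [i = iota x].  In the Abelian group obtained from [H]
    by choosing [e] as zero, [n |> x] is the [n]-th multiple of [i], so
    [n |-> n |> x] is the arithmetic progression determined by [0 |> x = e] and
    [(n + 1) |> x = [n |> x, e, i]].  Each module law equates two arithmetic
    progressions with the same step and the same value at [0].  The
    multiplicative law moreover uses that [eps] and [iota] send [n |> x] to [e]
    and to [n |> x] respectively. *)

Set Implicit Arguments.
Unset Strict Implicit.
Unset Printing Implicit Defensive.

Import Order.TTheory GRing.Theory Num.Theory.
Local Open Scope ring_scope.

(** With [w = [t, z, y]], one has [t = [w, y, z]] and [z = [y, w, t]]. Hence [[x, y, z] =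
    [x, w, t]], and then [t] cancels. *)
Lemma heap_assoc_mid (H : Type) (br : H -> H -> H -> H) (hH : heap br)
  x y z t u : br (br x y z) t u = br x (br t z y) u.
Proof.
case: hH => _ hA hl hr; set w := br t z y.
have -> : t = br w y z by rewrite /w -hA hl hr.
have {1}-> : z = br y w (br w y z) by rewrite hA hr hl.
by rewrite hA hr -hA hl.
Qed.

Section AbelianHeap.

Variables (H : Type) (br : H -> H -> H -> H).
Hypothesis hH : abelian_heap br.

Let hA := heap_assoc (abelian_heap_heap hH).
Let hl := heap_malcev_l (abelian_heap_heap hH).
Let hr := heap_malcev_r (abelian_heap_heap hH).
Let hC := abelian_heap_sym hH.

Lemma br_swap_neg p b c d g : br (br p b c) d g = br (br p d c) b g.
Proof. by rewrite !(heap_assoc_mid (abelian_heap_heap hH)) (hC d). Qed.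

Lemma br_swap_pos p b c d g : br (br p b c) d g = br (br p b g) d c.
Proof. by rewrite -!hA (hC c). Qed.

Lemma br_swap p b c d g : br (br p b c) d g = br (br p d g) b c.
Proof. by rewrite br_swap_neg br_swap_pos. Qed.

(** Both sides unfold to left-nested brackets that differ by permuting entries of equal sign. This
    makes a bracket of three progressions a progression again, as needed in [int_actDr]. *)
Lemma br_medial a b c d e f g h i :
  br (br a b c) (br d e f) (br g h i) = br (br a d g) (br b e h) (br c f i).
Proof.
rewrite -!(heap_assoc_mid (abelian_heap_heap hH)) !hA.
rewrite (br_swap (br a b c)) (br_swap a b c).
by rewrite (br_swap_neg (br (br a d g) b c) f) (br_swap (br a d g) b c).
Qed.

Lemma br_stepK a b u : br (br u a b) b a = u.
Proof. by rewrite -hA hl hr. Qed.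

Lemma int_progression_unique a b (f g : int -> H) :
  (forall n, f (n + 1) = br (f n) a b) ->
  (forall n, g (n + 1) = br (g n) a b) ->
  f 0 = g 0 -> f =1 g.
Proof.
move=> fS gS fg0; elim/int_ind => // n IH.
  by rewrite intS addrC fS gS IH.
(* Downwards, the step is undone by [[-, b, a]]. *)
rewrite -(br_stepK a b (f _)) -(br_stepK a b (g _)) -fS -gS.
by have -> : - n.+1%:Z + 1 = - n%:Z; [rewrite intS; ring | rewrite IH].
Qed.

Variables eps iota : H -> H.

Notation act := (int_act br eps iota).

Lemma int_act0 x : act 0 x = eps x.
Proof. by []. Qed.

Lemma int_actS n x : act (n + 1) x = br (act n x) (eps x) (iota x).
Proof.
(* The cases are [n = 0], [n > 0], [n = -1] and [n < -1]. *)
case: n => [[|n]|[|n]].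
- by rewrite /= int_act0 hl.
- have -> : Posz n.+1 + 1 = Posz n.+2 by rewrite -PoszD addn1.
  by rewrite /int_act /= /alternate /= odd_double.
- by rewrite /int_act /= /alternate /= -hA hl hr.
(* Below [-1], the alternating bracket for [n] is the one for [n + 1] with [iota x, eps x] appended;
   the step cancels these two entries. *)
have -> : Negz n.+1 + 1 = Negz n by rewrite !NegzE !intS; ring.
rewrite /int_act [iter_br br `|Negz n.+1| _]/=.
by rewrite /alternate [odd _]/= [odd (_.+2)]/= /= odd_double /= br_stepK.
Qed.

Lemma int_actD m n x : act (m + n) x = br (act m x) (eps x) (act n x).
Proof.
apply: (@int_progression_unique (eps x) (iota x) (fun n => act (m + n) x)
  (fun n => br (act m x) (eps x) (act n x))) => [k|k|].
- by rewrite addrA int_actS.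
- by rewrite int_actS hA.
by rewrite addr0 int_act0 hr.
Qed.

Lemma int_actDl l m n x :
  act (int_br l m n) x = br (act l x) (act m x) (act n x).
Proof.
(* Writing [l] as [(l - m) + m] lets [act m x] cancel on the right. *)
rewrite /int_br int_actD -{2}(subrK m l) (int_actD (l - m) m).
by rewrite -hA hl.
Qed.

Hypothesis heps : heap_endomorphism br eps.
Hypothesis hiota : heap_endomorphism br iota.

Lemma int_actDr n x y z : act n (br x y z) = br (act n x) (act n y) (act n z).
Proof.
apply: (@int_progression_unique (eps (br x y z)) (iota (br x y z))
  (fun n => act n (br x y z))
  (fun n => br (act n x) (act n y) (act n z))) => [k|k|].
- exact: int_actS.
- by rewrite !int_actS heps hiota br_medial.
by rewrite !int_act0 heps.
Qed.

Hypotheses (eps_idem : idempotent_fun eps) (iota_idem : idempotent_fun iota).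
Hypotheses (eps_iota : eps \o iota =1 eps) (iota_eps : iota \o eps =1 eps).

(** The image under [eps] has step [[-, eps x, eps x]], so it is constant. *)
Lemma eps_int_act n x : eps (act n x) = eps x.
Proof.
apply: (@int_progression_unique (eps x) (eps x) (fun n => eps (act n x))
  (fun=> eps x)) => [k|k|].
- by rewrite int_actS heps [eps (eps x)]eps_idem [eps (iota x)]eps_iota.
- by rewrite hl.
exact: eps_idem.
Qed.

Lemma iota_int_act n x : iota (act n x) = act n x.
Proof.
apply: (@int_progression_unique (eps x) (iota x) (fun n => iota (act n x))
  (act^~ x)) => [k|k|].
- by rewrite int_actS hiota [iota (eps x)]iota_eps [iota (iota x)]iota_idem.
- exact: int_actS.
exact: iota_eps.
Qed.

Lemma int_actM m n x : act (m * n) x = act m (act n x).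
Proof.
(* Both sides are progressions in [m], with [n] fixed. *)
apply: (@int_progression_unique (eps x) (act n x) (fun m => act (m * n) x)
  (act^~ (act n x))) => [k|k|].
- by rewrite mulrDl mul1r int_actD.
- by rewrite int_actS eps_int_act iota_int_act.
by rewrite mul0r !int_act0 eps_int_act.
Qed.

End AbelianHeap.

Lemma int_abelian_heap : abelian_heap int_br.
Proof.
rewrite /int_br; split; first split=> *; try ring; first exact: inhabits 0.
by move=> *; ring.
Qed.

Lemma int_truss : truss int_br (fun m n : int => m * n).
Proof.
split; [exact: int_abelian_heap | exact: mulrA | |];
  by rewrite /int_br => *; ring.
Qed.

Local Close Scope ring_scope.

Theorem corollary4p8 (H : Type) (br : H -> H -> H -> H)
  (hH : abelian_heap br)
  (eps iota : H -> H)
  (heps : heap_endomorphism br eps) (hiota : heap_endomorphism br iota)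
  (eps_idem : idempotent_fun eps) (iota_idem : idempotent_fun iota)
  (eps_iota : eps \o iota =1 eps) (iota_eps : iota \o eps =1 eps) :
  left_module int_br (fun m n : int => (m * n)%R) br (int_act br eps iota).
Proof.
split.
- exact: int_truss.
- exact: hH.
- by move=> m n x; apply: int_actM.
- by move=> n x y z; apply: int_actDr.
- by move=> l m n x; apply: int_actDl.
Qed.
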